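(* For $n\in\mathbb{N}$, the multiplicative semigroup $M_n(\mathbb{T}_{[0,1]})$ of $n\times n$ matrices over $\mathbb{T}_{[0,1]}$ is permutable if and only if $n=1$.
   Context: $\mathbb{N}$ denotes the natural numbers excluding $0$. $\mathbb{T}_{[0,1]}$ is the semiring with underlying set $[0,1]\cup\{-\infty\}$ ($[0,1]$ the real interval), with maximum as addition and truncated addition $(a,b)\mapsto\min(a+b,1)$ as multiplication ($+$ classical, $-\infty+a=-\infty$). Matrix multiplication is induced from these operations in the usual way. A semigroup $T$ is permutable (also called strongly permutable) if there exists $k\geq 2$ such that for all $s_1,\dots,s_k\in T$ there is a non-identity permutation $\sigma$ of $\{1,\dots,k\}$ with $s_{\sigma(1)}\cdots s_{\sigma(k)}=s_1\cdots s_k$. *)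

(* Defs.v *)
From HB Require Import structures.
From mathcomp Require Import all_boot all_order all_fingroup all_algebra.
From mathcomp Require Import reals constructive_ereal.
From mathcomp Require Import lra.

Set Implicit Arguments.
Unset Strict Implicit.
Unset Printing Implicit Defensive.

Import Order.TTheory GRing.Theory Num.Theory.
Local Open Scope ring_scope.

Section TruncatedTropical.
Variable R : realType.
Local Open Scope ereal_scope.

Definition in_trop01 (x : \bar R) : bool := (x == -oo) || (0 <= x <= 1).

(* The semiring T_[0,1].  Its addition and multiplication are those of the
   instances declared below: 0%R is -oo, 1%R is 0%:E, x + y is the maximum and
   x * y is the truncated sum (adde satisfies -oo + a = -oo). *)
Record trop01 := Trop01 { trop01_val :> \bar R; _ : in_trop01 trop01_val }.

HB.instance Definition _ := [isSub for trop01_val].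
HB.instance Definition _ := [Choice of trop01 by <:].

Lemma trop01_zero_subproof : in_trop01 -oo.
Proof. by rewrite /in_trop01 eqxx. Qed.

Lemma trop01_one_subproof : in_trop01 0.
Proof. by rewrite /in_trop01 lexx lee_fin ler01 orbT. Qed.

Lemma trop01_add_subproof (x y : trop01) :
  in_trop01 (Order.max (x : \bar R) (y : \bar R)).
Proof. by case: x y => [x hx] [y hy] /=; case: leP. Qed.

Variant trop01_spec : \bar R -> Prop :=
| Trop01Ninfty : trop01_spec -oo
| Trop01Fin (r : R) of (0 <= r <= 1)%R : trop01_spec r%:E.

Lemma trop01P (x : \bar R) : in_trop01 x -> trop01_spec x.
Proof.
case/orP => [/eqP->|]; first by left.
case: x => [r||] /andP[x0 x1].
- by right; rewrite -!lee_fin x0.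
- by rewrite leye_eq in x1.
- by rewrite leeNy_eq in x0.
Qed.

Lemma trop01_mul_subproof (x y : trop01) :
  in_trop01 (Order.min ((x : \bar R) + y) 1).
Proof.
case: x y => [x hx] [y hy] /=.
case: (trop01P hx) => [|r /andP[r0 _]]; last first.
  case: (trop01P hy) => [|t /andP[t0 _]]; last first.
    rewrite /in_trop01 ge_min lexx orbT andbT le_min lee01 andbT.
    by rewrite -EFinD lee_fin addr_ge0 ?orbT.
  by rewrite addeNy /in_trop01 min_l ?leNye ?eqxx.
by rewrite addNye /in_trop01 min_l ?leNye ?eqxx.
Qed.

Definition trop01_zero : trop01 := Trop01 trop01_zero_subproof.
Definition trop01_one : trop01 := Trop01 trop01_one_subproof.
Definition trop01_add (x y : trop01) : trop01 := Trop01 (trop01_add_subproof x y).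
Definition trop01_mul (x y : trop01) : trop01 := Trop01 (trop01_mul_subproof x y).

Lemma trop01_addA : associative trop01_add.
Proof. by move=> x y z; apply/val_inj; rewrite /= maxA. Qed.

Lemma trop01_addC : commutative trop01_add.
Proof. by move=> x y; apply/val_inj; rewrite /= maxC. Qed.

Lemma trop01_add0 : left_id trop01_zero trop01_add.
Proof. by move=> x; apply/val_inj; rewrite /= max_r ?leNye. Qed.

Lemma trop01_mulA : associative trop01_mul.
Proof.
have minNy : Order.min (-oo : \bar R) 1 = -oo by rewrite min_l ?leNye.
move=> [x hx] [y hy] [z hz]; apply/val_inj => /=.
case: (trop01P hx) => [|r /andP[r0 r1]]; first by rewrite !addNye minNy addNye.
case: (trop01P hy) => [|s /andP[s0 s1]].
  by rewrite !(addNye, addeNy) minNy !(addNye, addeNy).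
case: (trop01P hz) => [|t /andP[t0 t1]].
  by rewrite !(addNye, addeNy) minNy !(addNye, addeNy).
rewrite -!EFinD -!EFin_min; congr (_%:E).
by case: (leP (s + t) 1)%R => ?; case: (leP (r + s) 1)%R => ?;
  do 2![case: leP => ?]; lra.
Qed.

Lemma trop01_mulC : commutative trop01_mul.
Proof. by move=> x y; apply/val_inj; rewrite /= addeC. Qed.

Lemma trop01_mul1 : left_id trop01_one trop01_mul.
Proof.
move=> [x hx]; apply/val_inj; rewrite /= add0e min_l //.
by case/orP: hx => [/eqP->|/andP[]] //; rewrite leNye.
Qed.

Lemma trop01_mulDl : left_distributive trop01_mul trop01_add.
Proof.
move=> [x hx] [y hy] [z hz]; apply/val_inj; rewrite /= -min_maxl.
congr Order.min.
by case: (leP x y) => xy; [rewrite max_r // leeD2r|rewrite max_l // leeD2r // ltW].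
Qed.

Lemma trop01_mul0 : left_zero trop01_zero trop01_mul.
Proof. by move=> x; apply/val_inj; rewrite /= min_l ?leNye. Qed.

Lemma trop01_one_neq0 : trop01_one != trop01_zero.
Proof. by []. Qed.

HB.instance Definition _ :=
  GRing.isNmodule.Build trop01 trop01_addA trop01_addC trop01_add0.
HB.instance Definition _ := GRing.Nmodule_isComNzSemiRing.Build trop01
  trop01_mulA trop01_mulC trop01_mul1 trop01_mulDl trop01_mul0 trop01_one_neq0.

End TruncatedTropical.

Definition mul_semigroup (A : pzSemiRingType) : Type := A.

HB.instance Definition _ (A : pzSemiRingType) := Choice.on (mul_semigroup A).
HB.instance Definition _ (A : pzSemiRingType) :=
  isSemigroup.Build (mul_semigroup A) (@mulrA A).

(* A semigroup need not have a unit, so the product s_0 * ... * s_k is only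
   defined for nonempty families. *)
Definition sgprod (S : semigroupType) (k : nat) (s : 'I_k.+1 -> S) : S :=
  foldl (fun x y => (x * y)%g) (s ord0) [seq s (lift ord0 i) | i <- enum 'I_k].

(* k.+2 ranges over the lengths >= 2. *)
Definition permutable (S : semigroupType) : Prop :=
  exists k : nat, forall s : 'I_k.+2 -> S,
    exists2 sigma : 'S_k.+2, sigma != 1%g & sgprod (s \o sigma) = sgprod s.

(* Main.v *)
Require Import Defs.
From HB Require Import structures.
From mathcomp Require Import all_boot all_order all_fingroup all_algebra.
From mathcomp Require Import reals constructive_ereal.
From mathcomp Require Import lra.

(** For [n = 1] the semigroup is commutative, so exchanging two factors
preserves every product.

For [n >= 2] and any length [k >= 2], one exhibits [k] matrices whose product
changes under every permutation other than the identity.  The matrices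
[[x, y], [0, 1]], placed at two distinct indices, multiply like affine maps
([affmx_mul]); hence the product of the matrices with fixed diagonal entry [d]
and corner entries [a_0, ..., a_(k-1)] has corner [\sum_j d ^+ j * a_j]
([sgprod_affmx]).  In the tropical semiring, read [d] as the processing time of
a unit job and [a_i] as minus the due date of job [i]: up to truncation the
corner is the maximal lateness of the schedule.  When the due dates are
[0, 1, ..., k-1] up to a shift, executing the jobs in order makes every job
equally late, and any other schedule delays some job strictly more.  So the
identity is the unique minimizer of the corner.

Concretely, with [q m = min (m / k, 1)] the choice is [d = q 1] and
[a_i = q (k - 1 - i)].  The identity yields [(k - 1) / k], which is less than 1,
while a permutation running some job [i] at a later place [j > i] has a term
[q (j + k - 1 - i) = 1], so truncation cannot hide the difference.  A
permutation without such a job satisfies [j <= sigma j] for all [j], which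
forces it to be the identity ([perm_eq1_of_leq]). *)

Set Implicit Arguments.
Unset Strict Implicit.
Unset Printing Implicit Defensive.

Import Order.TTheory GRing.Theory Num.Theory.
Local Open Scope ring_scope.

(** * Products in a semigroup *)

Lemma sgprod0 (S : semigroupType) (s : 'I_1 -> S) : sgprod s = s ord0.
Proof. by rewrite /sgprod enum_ord0. Qed.

Lemma sgprod_recr (S : semigroupType) (k : nat) (s : 'I_k.+2 -> S) :
  sgprod s = (sgprod (fun i : 'I_k.+1 => s (widen_ord (leqnSn _) i))
              * s ord_max)%g.
Proof.
rewrite /sgprod enum_ordSr map_rcons foldl_rcons -map_comp.
congr (foldl _ _ _ * s _)%g; last exact/val_inj.
  by congr s; apply/val_inj.
by apply: eq_map => i /=; congr s; apply/val_inj.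
Qed.

Lemma commutative_permutable (S : semigroupType) :
  (forall x y : S, x * y = y * x)%g -> permutable S.
Proof.
move=> mulC; exists 0%N => s; exists (tperm ord0 ord_max).
  by apply/eqP => /permP /(_ ord0); rewrite tpermL perm1.
rewrite !sgprod_recr !sgprod0 /=.
have -> : widen_ord (leqnSn 1) ord0 = ord0 by apply/val_inj.
by rewrite tpermL tpermR mulC.
Qed.

(** * Affine matrices *)

Section AffineMatrices.
Variables (S : pzSemiRingType) (n : nat) (i l : 'I_n).
Hypothesis neq_il : i != l.

(** The matrix of the affine map [t |-> x * t + y], sitting in rows and columns
[i] and [l] and padded with zeros. *)
Definition affmx (x y : S) : 'M[S]_n :=
  \matrix_(r, c) (if r == i then (if c == i then x else y *+ (c == l))
                  else ((r == l) && (c == l))%:R).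

Lemma affmx_mul (x y x' y' : S) :
  affmx x y *m affmx x' y' = affmx (x * x') (x * y' + y).
Proof.
have neq_li : (l == i) = false by rewrite eq_sym (negbTE neq_il).
apply/matrixP => r c; rewrite !mxE (bigD1 i) //= (bigD1 l) ?neq_li //=.
rewrite big1 ?addr0 => [|j /andP[/negbTE ji /negbTE jl]]; last first.
  by rewrite !mxE ji jl /= mulr0.
rewrite !mxE !eqxx neq_li /=.
case: (eqVneq r i) => [_|_].
  case: (eqVneq c i) => [->|_]; first by rewrite (negbTE neq_il) mulr0 addr0.
  by case: (c == l); rewrite ?mulr1 ?mulr0 ?addr0.
by rewrite (negbTE neq_il) !andbF andbT mul0r add0r -natrM mulnb.
Qed.

(** Composing the affine maps [t |-> d * t + a_j] is Horner evaluation at [d]; the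
order of the factors is recorded in the powers of [d]. *)
Lemma sgprod_affmx (d : S) (k : nat) (a : 'I_k.+1 -> S) :
  sgprod (fun j => affmx d (a j) : mul_semigroup 'M[S]_n) =
  affmx (d ^+ k.+1) (\sum_(j < k.+1) d ^+ j * a j).
Proof.
elim: k => [|k IHk] in a *.
  by rewrite sgprod0 big_ord1 expr1 mul1r.
rewrite sgprod_recr IHk [in RHS]big_ord_recr /= [in RHS]exprSr [in RHS]addrC.
exact: affmx_mul.
Qed.

End AffineMatrices.

(** * Truncated multiples of 1/k *)

Section Steps.
Variables (R : realType) (k : nat).

Lemma step_subproof (m : nat) :
  in_trop01 ((Num.min (m%:R / k.+1%:R) 1 : R)%:E).
Proof.
rewrite /in_trop01 !lee_fin le_min ler01 ge_min lexx orbT !andbT.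
by rewrite divr_ge0.
Qed.

Definition step (m : nat) : trop01 R := Trop01 (step_subproof m).

(** Truncation commutes with sums of nonnegative reals, so tropical
multiplication of steps adds their indices. *)
Lemma stepD (m p : nat) : step (m + p) = step m * step p.
Proof.
apply/val_inj => /=; rewrite -EFinD -EFin_min; congr (_%:E).
rewrite natrD mulrDl.
have : 0 <= m%:R / k.+1%:R :> R by rewrite divr_ge0.
have : 0 <= p%:R / k.+1%:R :> R by rewrite divr_ge0.
move: (m%:R / _) (p%:R / _) => x y y0 x0.
by case: (leP x 1) => ?; case: (leP y 1) => ?; do 2?[case: leP => ?]; lra.
Qed.

Lemma stepX (m : nat) : step 1 ^+ m = step m.
Proof.
elim: m => [|m IHm]; last by rewrite exprS IHm -stepD.
by apply/val_inj; rewrite /= mul0r min_l ?ler01.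
Qed.

Lemma trop01_addxx (x : trop01 R) : x + x = x.
Proof. by apply/val_inj; rewrite /= maxxx. Qed.

Lemma trop01_mulSn (x : trop01 R) (m : nat) : x *+ m.+1 = x.
Proof. by elim: m => // m IHm; rewrite mulrS IHm trop01_addxx. Qed.

(** The value [k / (k + 1)] of [step k] lies below the truncation threshold and
is the last such value, so comparing with it is insensitive to truncation. *)
Lemma step_add_absorb (m : nat) : step m + step k = step k -> (m <= k)%N.
Proof.
have k0 : 0 < k.+1%:R :> R by rewrite ltr0n.
move/(congr1 val) => /= /max_idPr; rewrite lee_fin le_min => /andP[+ _].
rewrite ge_min !ler_pdivlMr // divfK ?gt_eqF // mul1r !ler_nat.
by rewrite ltnn orbF.
Qed.

End Steps.

(** * Permutability of matrix semigroups *)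

Lemma perm_eq1_of_leq (n : nat) (sigma : 'S_n) :
  (forall j : 'I_n, j <= sigma j)%N -> sigma = 1%g.
Proof.
(* The two sides have equal sums, so no inequality can be strict. *)
move=> le_sigma; have sum_sigma : (\sum_(j < n) j = \sum_(j < n) sigma j)%N.
  exact: (reindex_inj (@perm_inj _ sigma)).
have [_ /esym] := leqif_sum (fun j (_ : true) => leqif_eq (le_sigma j)).
rewrite sum_sigma eqxx => /forallP eq_sigma.
by apply/permP => j; rewrite perm1; apply/val_inj/esym/eqP; exact: eq_sigma.
Qed.

(** The affine matrices of the unit-job schedule with [k + 2] jobs; any two
distinct indices [i] and [l] can carry them. *)
Lemma not_permutable_matrix (R : realType) (n : nat) :
  (1 < n)%N -> ~ permutable (mul_semigroup 'M[trop01 R]_n).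
Proof.
move=> n1 [k perm_k].
pose i := Ordinal (ltnW n1); pose l := Ordinal n1.
have neq_il : i != l by [].
pose q := step R k.+1; pose a (j : 'I_k.+2) := q (k.+1 - j)%N.
have [sigma /eqP + eq_prod] :=
  perm_k (fun j => affmx i l (q 1%N) (a j) : mul_semigroup 'M[trop01 R]_n).
apply; apply: perm_eq1_of_leq => j.
have prodE := sgprod_affmx neq_il (q 1%N).
have /matrixP/(_ i l) := etrans (esym (prodE _ (a \o sigma)))
                                (etrans eq_prod (prodE _ a)).
rewrite !mxE eqxx /= !mulr1n.
(* Executed in order, all jobs are equally late. *)
have -> : \sum_(j < k.+2) q 1%N ^+ j * a j = q k.+1.
  rewrite (eq_bigr (fun=> q k.+1)) => [|p _]; last first.
    by rewrite stepX -stepD subnKC // -ltnS.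
  by rewrite sumr_const card_ord trop01_mulSn.
move=> sum_sigma.
(* Since addition is the maximum, each summand is absorbed by the sum. *)
have : q 1%N ^+ j * a (sigma j) + q k.+1 = q k.+1.
  by rewrite -sum_sigma (bigD1 j) //= addrA trop01_addxx.
rewrite stepX -stepD => /step_add_absorb.
by rewrite addnBA ?leq_subLR ?leq_add2r // -ltnS.
Qed.

Theorem corollary4p2 (R : realType) (n : nat) (hn : (0 < n)%N) :
  permutable (mul_semigroup 'M[trop01 R]_n) <-> n = 1%N.
Proof.
split=> [perm_n | ->].
  case: (ltnP 1 n) => [n1|]; first by have := not_permutable_matrix n1 perm_n.
  by case: n hn {perm_n} => [|[]].
apply: commutative_permutable => x y; apply/matrixP => r c.
rewrite [LHS](_ : _ = ((x : 'M_1) *m (y : 'M_1)) r c) //.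
rewrite [RHS](_ : _ = ((y : 'M_1) *m (x : 'M_1)) r c) //.
by rewrite !mxE !big_ord1 mulrC !ord1.
Qed.
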